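(* Let $f\in C^1(\mathbb{R}^n;\mathbb{R}^n)$ and $g\in C^1(\mathbb{R}^n\times\mathbb{R};\mathbb{R})$. Consider the system $$\dot x=f(x),\quad x\in\mathbb{R}^n,\qquad (1)$$ $$\dot y=g(x,y),\quad y\in\mathbb{R}.\qquad (2)$$ Let $(x_0,y_0)\in\mathbb{R}^n\times\mathbb{R}$ be a point for which the solution $(x(t),y(t))$ of the initial value problem (1), (2) with initial condition $(x(0),y(0))=(x_0,y_0)$ is bounded. Let $T>0$ and suppose that $\omega(x_0)$ contains a $T$-periodic orbit of system (1), where $\omega(x_0)$ is the omega limit set of $x_0\in\mathbb{R}^n$ for system (1). Then $\omega(x_0,y_0)$ contains a $T$-periodic orbit of system (1), (2), where $\omega(x_0,y_0)$ is the omega limit set of $(x_0,y_0)\in\mathbb{R}^n\times\mathbb{R}$ for system (1), (2).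
   Context: For an autonomous system $\dot z=F(z)$, $z\in\mathbb{R}^N$, with $F$ locally Lipschitz, and a point $z_0$ whose solution $z(t)$ with $z(0)=z_0$ is defined for all $t\ge 0$, the omega limit set is $\omega(z_0)=\{y\in\mathbb{R}^N:\exists\{t_k\ge 0:k=1,2,\ldots\}\text{ with }\lim_{k\to+\infty}t_k=+\infty\text{ and }\lim_{k\to+\infty}z(t_k)=y\}$. ''Bounded solution'' means defined and bounded for all $t\ge 0$. A $T$-periodic orbit is a set $\{z^*(t):t\in[0,T]\}$ where $z^*$ is a solution satisfying $z^*(t+T)=z^*(t)$ for all $t\ge 0$; equilibrium points count as periodic orbits. *)

(* Defs.v *)
From HB Require Import structures.
From mathcomp Require Import all_boot all_order all_algebra.
From mathcomp Require Import all_classical all_reals all_analysis.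

Set Implicit Arguments.
Unset Strict Implicit.
Unset Printing Implicit Defensive.

Import Order.TTheory GRing.Theory Num.Theory.
Import numFieldNormedType.Exports.

Local Open Scope classical_set_scope.
Local Open Scope ring_scope.

(* Class C^1: Fréchet differentiable everywhere, with a derivative
   z |-> 'd F z that is continuous for the operator norm. *)
Definition classC1 (R : realType) (V W : normedModType R) (F : V -> W) : Prop :=
  (forall z, differentiable F z) /\
  (forall z (e : R), 0 < e ->
     \forall z' \near z, forall v, `|'d F z' v - 'd F z v| <= e * `|v|).

(* The derivative is taken relative to [0, +oo[ (hence one-sided at t = 0);
   the values of z at negative times are irrelevant. *)
Definition solution (R : realType) (V : normedModType R)
    (F : V -> V) (z : R -> V) : Prop :=
  forall t, 0 <= t ->
    (fun s => (s - t)^-1 *: (z s - z t)) @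
      within [set s | 0 <= s] t^' --> F (z t).

(* For F locally Lipschitz the solution z issued from z0 is unique, so that
   "exists z" designates it; omega F z0 is only of interest when it is defined
   for all nonnegative times. *)
Definition omega (R : realType) (V : normedModType R)
    (F : V -> V) (z0 : V) : set V :=
  [set w | exists2 z : R -> V, solution F z /\ z 0 = z0 &
     exists t : R^nat, [/\ forall k, 0 <= t k,
       t k @[k --> \oo] --> +oo & z (t k) @[k --> \oo] --> w]].

(* T need not be the minimal period: equilibria are T-periodic orbits. *)
Definition periodic_orbit (R : realType) (V : normedModType R)
    (F : V -> V) (T : R) (O : set V) : Prop :=
  exists z : R -> V, [/\ solution F z,
    forall t, 0 <= t -> z (t + T) = z t & O = z @` `[0, T]].

Definition cascade (R : realType) (n : nat) (f : 'rV[R]_n -> 'rV[R]_n)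
    (g : 'rV[R]_n * R -> R) (p : 'rV[R]_n * R) : 'rV[R]_n * R :=
  (f p.1, g p).

(* Main.v *)
Require Import Defs.
From HB Require Import structures.
From mathcomp Require Import all_boot all_order all_algebra.
From mathcomp Require Import all_classical all_reals all_analysis.
From mathcomp Require Import lra.

Set Implicit Arguments.
Unset Strict Implicit.
Unset Printing Implicit Defensive.

Import Order.TTheory GRing.Theory Num.Theory.
Import numFieldNormedType.Exports.

(** The theorem holds because the fibre coordinate is one-dimensional: orbits of
    a scalar equation cannot cross, so the map that follows the flow over the
    given periodic orbit for one period is monotone in that coordinate, and a
    monotone self-map of a nonempty compact set of reals has a fixed point.

    Let z = (x, y) be the bounded solution, let x* be the periodic orbit and
    p = x*(0), and let K be the set of the q such that (p, q) is a limit point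
    of z.  K is closed and bounded, and nonempty since y is bounded
    ([traj_limit_lift]).  The limit set of z is invariant
    ([limit_set_invariant]): from (p, q), q in K, issues a solution w_q that
    stays in it.  Its first component solves the same initial value problem as
    x*, so w_q(T) = (p, P(q)) with P(q) in K.  Two solutions over x* whose
    y-components exchange their order meet by the intermediate value theorem,
    and then coincide; hence P is monotone ([cascade_monotone]) and has a fixed
    point q ([monotone_fixpoint]).  Since w_q(T) = w_q(0), uniqueness makes w_q
    T-periodic, and its orbit lies in the limit set.

    Uniqueness of solutions and invariance of the limit set both come from one
    estimate, Gronwall's inequality for two solutions in a ball where the
    vector field is Lipschitz ([solution_dist]).  The solution through a limit
    point w0 is built from z itself: if z(t_k) tends to w0, the estimate makes
    (z(t_k + s))_k a Cauchy sequence for each s, and the pointwise limit is a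
    solution because a first-order Taylor bound that does not depend on k
    ([solution_taylor]) passes to the limit. *)

Local Open Scope classical_set_scope.
Local Open Scope ring_scope.

(** * Differential inequalities *)

(** Differentiability relative to A, stated without dividing: the difference
    quotients of [solution] and the differentials of [classC1] both reduce to
    this form, which makes sense at end points of intervals. *)
Definition deriv_at {R : realType} {V : normedModType R}
    (A : set R) (u : R -> V) (t : R) (v : V) : Prop :=
  forall e, 0 < e -> exists2 d, 0 < d & forall s, A s -> `|s - t| < d ->
    `|u s - u t - (s - t) *: v| <= e * `|s - t|.

Lemma deriv_at_sub (R : realType) (V : normedModType R) (A B : set R)
    (u : R -> V) (t : R) (v : V) :
  B `<=` A -> deriv_at A u t v -> deriv_at B u t v.
Proof. by move=> BA du e /du[d d0 H]; exists d => // s /BA; exact: H. Qed.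

Lemma deriv_atB (R : realType) (V : normedModType R) (A : set R)
    (u1 u2 : R -> V) (t : R) (v1 v2 : V) :
  deriv_at A u1 t v1 -> deriv_at A u2 t v2 ->
  deriv_at A (fun s => u1 s - u2 s) t (v1 - v2).
Proof.
move=> du1 du2 e e0; have e20 : 0 < e / 2 by lra.
have [d1 d10 H1] := du1 _ e20; have [d2 d20 H2] := du2 _ e20.
exists (Num.min d1 d2); first by rewrite lt_min d10.
move=> s As; rewrite lt_min => /andP[s1 s2].
rewrite scalerBr (_ : _ - _ - _ = (u1 s - u1 t - (s - t) *: v1) -
    (u2 s - u2 t - (s - t) *: v2)); last first.
  by rewrite !opprD !opprK [RHS]addrACA [in RHS](addrACA (u1 s)).
apply: (le_trans (ler_normB _ _)).
have := H1 s As s1; have := H2 s As s2; lra.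
Qed.

Lemma deriv_at_scale (R : realType) (V : normedModType R) (A : set R) t (v : V) :
  deriv_at A (fun s => s *: v) t v.
Proof.
move=> e e0; exists 1 => // s _ _.
by rewrite -scalerBl subrr normr0 mulr_ge0 // ltW.
Qed.

Lemma deriv_at_cst (R : realType) (V : normedModType R) (A : set R) t (w : V) :
  deriv_at A (fun=> w) t 0.
Proof.
move=> e e0; exists 1 => // s _ _.
by rewrite subrr scaler0 subr0 normr0 mulr_ge0 // ltW.
Qed.

Lemma deriv_at_continuous (R : realType) (V : normedModType R) (A : set R)
    (u : R -> V) (t : R) (v : V) :
  deriv_at A u t v -> forall e, 0 < e -> exists2 d, 0 < d &
    forall s, A s -> `|s - t| < d -> `|u s - u t| <= e.
Proof.
move=> du e e0; have [d d0 H] := du 1 ltr01.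
have v0 : 0 < `|v| + 1 by rewrite ltr_wpDl.
exists (Num.min d (e / (`|v| + 1))); first by rewrite lt_min d0 divr_gt0.
move=> s As; rewrite lt_min ltr_pdivlMr // => /andP[/(H s As) {}H st].
rewrite -[u s - u t](subrK ((s - t) *: v)); apply: (le_trans (ler_normD _ _)).
by move: H st; rewrite normrZ; lra.
Qed.

(** The supremum of the initial segments on which P holds can only be b: P
    extends to it by the closure hypothesis, and beyond it by the other. *)
Lemma real_induction (R : realType) (a b : R) (P : R -> Prop) : P a ->
    (forall t, a <= t < b -> (forall s, a <= s <= t -> P s) ->
      exists2 d, 0 < d & forall s, t < s < t + d -> s <= b -> P s) ->
    (forall t, a < t <= b -> (forall s, a <= s < t -> P s) -> P t) ->
  forall t, a <= t <= b -> P t.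
Proof.
move=> Pa step close t /andP[at_ tb].
have ab : a <= b by exact: le_trans tb.
pose S := [set r | a <= r <= b /\ forall s, a <= s <= r -> P s].
have Sa : S a by split=> [|s]; rewrite ?lexx // -eq_le => /eqP <-.
have Sub : has_ubound S by exists b => r [/andP[]].
have Ssup : has_sup S by split=> //; exists a.
have ac : a <= sup S by exact: ub_le_sup.
have cb : sup S <= b by apply: ge_sup; [exists a | move=> r [/andP[]]].
have Pltc s : a <= s < sup S -> P s.
  case/andP=> as_ sc; have [|r [_ Pr] rs] := @sup_adherent _ S (sup S - s) _ Ssup.
    by rewrite subr_gt0.
  by apply: Pr; rewrite as_ /=; move: rs; lra.
have Pc : P (sup S).
  have [<-//|ac'] := eqVneq a (sup S).
  by apply: close => //; rewrite lt_neqAle ac' ac.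
have Plec s : a <= s <= sup S -> P s.
  case/andP=> as_; rewrite le_eqVlt => /orP[/eqP->//|sc].
  by apply: Pltc; rewrite as_.
have [cb'|bc] := ltP (sup S) b; last by apply: Plec; rewrite at_ (le_trans tb).
have [|d d0 Pd] := step (sup S) _ Plec; first by rewrite ac.
pose m := Num.min (d / 2) (b - sup S).
have m0 : 0 < m by rewrite lt_min subr_gt0 cb' divr_gt0.
have md : m < d by apply: (@le_lt_trans _ _ (d / 2)); rewrite ?ge_min ?lexx //; lra.
have mb : m <= b - sup S by rewrite ge_min lexx orbT.
suff /(ub_le_sup Sub) : S (sup S + m) by lra.
split=> [|s /andP[as_ sm]]; first lra.
have [sc|cs] := leP s (sup S); first by apply: Plec; rewrite as_.
by apply: Pd; lra.
Qed.

(** While |u| lies below phi, phi grows faster than |u|, so it cannot be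
    overtaken to the right of a point; from the left, the bound passes to the
    limit because u is continuous and phi is nondecreasing as long as it
    dominates.  Taking phi affine or exponential gives the two inequalities
    below; convexity of these functions is what makes the last hypothesis hold
    on the whole of [t, b]. *)
Lemma norm_comparison (R : realType) (V : normedModType R) (a b : R)
    (u v : R -> V) (phi : R -> R) :
    (forall t, a <= t <= b -> deriv_at `[a, b] u t (v t)) ->
    `|u a| <= phi a ->
    (forall t, a <= t <= b -> `|u t| <= phi t ->
      exists2 c, `|v t| < c & forall s, t <= s <= b ->
        phi t + c * (s - t) <= phi s) ->
  forall t, a <= t <= b -> `|u t| <= phi t.
Proof.
move=> du ua hphi; apply: real_induction => // t /andP[at_ tb] IH.
  have atb : a <= t <= b by rewrite at_ ltW.
  have ut : `|u t| <= phi t by apply: IH; rewrite at_ /=.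
  have [c vc cphi] := hphi _ atb ut.
  have [|d d0 H] := du _ atb (c - `|v t|); first by rewrite subr_gt0.
  exists d => // s /andP[ts sd] sb.
  have st : `|s - t| = s - t by rewrite ger0_norm // subr_ge0 ltW.
  have := H s; rewrite st /= in_itv /=.
  have -> : a <= s <= b by lra.
  have -> : s - t < d by lra.
  move=> /(_ isT isT) {}H.
  have : phi t + c * (s - t) <= phi s by apply: cphi; lra.
  apply: le_trans.
  rewrite (_ : u s = u t + (s - t) *: v t + (u s - u t - (s - t) *: v t)); last first.
    by rewrite -[u s - _ - _]addrA -opprD [RHS]addrC subrK.
  apply: (le_trans (ler_normD _ _)).
  have := ler_normD (u t) ((s - t) *: v t); rewrite normrZ st; move: ut H; lra.
apply/ler_addgt0Pr => e e0.
have atb : a <= t <= b by rewrite (ltW at_).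
have [d d0 H] := deriv_at_continuous (du _ atb) e0.
pose s := Num.max a (t - d / 2).
have s_lt : s < t by rewrite gt_max at_ /=; lra.
have as_ : a <= s by rewrite le_max lexx.
have sd : t - d / 2 <= s by rewrite le_max lexx orbT.
have us : `|u s| <= phi s by apply: IH; rewrite as_.
have [|c vc cphi] := hphi s _ us; first lra.
have c0 : 0 < c := le_lt_trans (normr_ge0 _) vc.
have : phi s + c * (t - s) <= phi t by apply: cphi; lra.
have : 0 <= c * (t - s) by rewrite mulr_ge0 ?subr_ge0 // ltW.
have := H s; rewrite /= in_itv /= distrC ger0_norm ?subr_ge0; last exact: ltW.
have -> : a <= s <= b by lra.
have -> : t - s < d by lra.
move=> /(_ isT isT); have := ler_normB (u s) (u s - u t).
rewrite opprB addrC subrK; lra.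
Qed.

(** |u - u a| is compared with affine functions of slope slightly above M; the
    intermediate-point argument would fail for vector values. *)
Lemma mean_value_ineq (R : realType) (V : normedModType R) (a b M : R)
    (u v : R -> V) : a <= b ->
    (forall t, a <= t <= b -> deriv_at `[a, b] u t (v t)) ->
    (forall t, a <= t <= b -> `|v t| <= M) ->
  `|u b - u a| <= M * (b - a).
Proof.
move=> ab du vM; apply/ler_addgt0Pr => e e0.
have k0 : 0 < b - a + 1 by lra.
pose k := e / (b - a + 1); have kp : 0 < k by rewrite divr_gt0.
have ke : k * (b - a + 1) = e by rewrite divfK ?gt_eqF.
have : `|u b - u a| <= (M + k) * (b - a).
  apply: (@norm_comparison _ _ a b (fun s => u s - u a) (fun s => v s - 0)
    (fun s => (M + k) * (s - a))).
  - move=> t atb; apply: deriv_atB; [exact: du | exact: deriv_at_cst].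
  - by rewrite !subrr mulr0 normr0.
  - move=> t atb _; exists (M + k); first by
      rewrite subr0 (le_lt_trans (vM t atb)) // ltrDl.
    by move=> s _ /=; lra.
  - by rewrite ab lexx.
lra.
Qed.

(** The rate L + 1 instead of the optimal L leaves the strict margin that
    [norm_comparison] asks for. *)
Lemma gronwall (R : realType) (V : normedModType R) (a b L : R)
    (u v : R -> V) : a <= b -> 0 <= L ->
    (forall t, a <= t <= b -> deriv_at `[a, b] u t (v t)) ->
    (forall t, a <= t <= b -> `|v t| <= L * `|u t|) ->
  `|u b| <= `|u a| * expR ((L + 1) * (b - a)).
Proof.
move=> ab L0 du vL; apply/ler_addgt0Pr => e e0.
set E := expR _; have E0 : 0 < E by exact: expR_gt0.
pose k := e / E; have kp : 0 < k by rewrite divr_gt0.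
have ke : k * E = e by rewrite divfK ?gt_eqF.
have : `|u b| <= (`|u a| + k) * E.
  apply: (@norm_comparison _ _ a b u v
    (fun s => (`|u a| + k) * expR ((L + 1) * (s - a)))) => //.
  - by rewrite subrr mulr0 expR0 mulr1 lerDl ltW.
  - move=> t atb ut; set phi := (_ * _) in ut *.
    have phi0 : 0 < phi by rewrite mulr_gt0 ?expR_gt0 // ltr_wpDl.
    exists ((L + 1) * phi).
      apply: (le_lt_trans (vL _ atb)); apply: (le_lt_trans (ler_wpM2l L0 ut)).
      by lra.
    move=> s _; have -> : (L + 1) * (s - a) = (L + 1) * (t - a) + (L + 1) * (s - t).
      by lra.
    rewrite expRD [leRHS]mulrA -/phi.
    have := ler_wpM2l (ltW phi0) (expR_ge1Dx ((L + 1) * (s - t))); lra.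
  - by rewrite ab lexx.
rewrite mulrDl; lra.
Qed.

(** * Lipschitz bounds from compactness *)

(** The form in which finite dimension is used: it turns local bounds into
    uniform ones on balls, and makes bounded Cauchy sequences converge. *)
Definition heine_borel {R : realType} (V : normedModType R) : Prop :=
  forall M : R, compact [set v : V | `|v| <= M].

Definition lipschitz_on_balls {R : realType} {V W : normedModType R}
    (F : V -> W) : Prop :=
  forall M, exists2 L, 0 <= L &
    forall a b, `|a| <= M -> `|b| <= M -> `|F a - F b| <= L * `|a - b|.

(** Continuity of the differential bounds its operator norm near each point,
    hence uniformly on the compact ball; the mean value inequality along a
    segment, which stays in the ball by convexity, turns this bound into a
    Lipschitz constant. *)
Lemma classC1_lipschitz (R : realType) (V W : normedModType R) (F : V -> W) :
  heine_borel V -> classC1 F -> lipschitz_on_balls F.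
Proof.
move=> hV [dF dFc] M.
(* a uniform bound L on the operator norms over the ball *)
have [L [L0 dL]] : exists L, 0 <= L /\
    forall z, `|z| <= M -> forall v, `|'d F z v| <= L * `|v|.
  (* compactness, with i -> +oo as the candidate bound; near z the bound r + 2
     works, r + 1 coming from 'd F z and 1 from the variation of 'd F *)
  have /compact_near_coveringP/(_ R +oo (fun i z =>
      forall v, `|'d F z v| <= i * `|v|)) := hV M.
  case=> [z _|L0 [L0r HL]].
    have /linear_boundedP : bounded_near ('d F z) (nbhs 0).
      by apply/linear_bounded_continuous; exact: diff_continuous.
    case=> r [_ /(_ (r + 1))]; rewrite ltrDl ltr01 => /(_ isT) Hr.
    exists ([set z' | forall v, `|'d F z' v - 'd F z v| <= 1 * `|v|],
      [set i | r + 2 <= i]).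
      by split; [exact: dFc | apply: nbhs_pinfty_ge; rewrite num_real].
    case=> z' i [/= H1 H2] v.
    rewrite -['d F z' v](subrK ('d F z v)); apply: (le_trans (ler_normD _ _)).
    have := Hr v; have := H1 v; have := ler_wpM2r (normr_ge0 v) H2; lra.
  exists (Num.max 0 (L0 + 1)); rewrite le_max lexx; split=> // z zM v.
  by apply: (HL (Num.max 0 (L0 + 1))) => //; rewrite lt_max ltrDl ltr01 orbT.
exists L => // a b aM bM.
pose p t := b + t *: (a - b).
have pM t : 0 <= t <= 1 -> `|p t| <= M.
  move=> /andP[t0 t1]; rewrite (_ : p t = (1 - t) *: b + t *: a); last first.
    by rewrite /p scalerBr scalerBl scale1r addrA addrAC.
  apply: (le_trans (ler_normD _ _)); rewrite !normrZ !ger0_norm ?subr_ge0 //.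
  have t1' : 0 <= 1 - t by lra.
  have := ler_wpM2l t0 aM; have := ler_wpM2l t1' bM; lra.
have := @mean_value_ineq _ _ 0 1 (L * `|a - b|) (F \o p)
  (fun t => 'd F (p t) (a - b)) ler01.
have p1 : p 1 = a by rewrite /p scale1r addrC subrK.
have p0 : p 0 = b by rewrite /p scale0r addr0.
rewrite /= p1 p0 subr0 mulr1; apply=> t t01.
  move=> e e0; pose k := e / (`|a - b| + 1).
  have ab0 : 0 < `|a - b| + 1 by rewrite ltr_wpDl.
  have k0 : 0 < k by rewrite divr_gt0.
  have ke : k * (`|a - b| + 1) = e by rewrite divfK ?gt_eqF.
  have /diff_locally /eqaddoP /(_ k k0) /nbhs_normP [d /= d0 H] := dF (p t).
  exists (d / (`|a - b| + 1)); first by rewrite divr_gt0.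
  move=> s _; rewrite ltr_pdivlMr // => sd.
  have := H ((s - t) *: (a - b)); rewrite /ball_ /= sub0r normrN normrZ.
  have -> : `|s - t| * `|a - b| < d by have := normr_ge0 (s - t); lra.
  move=> /(_ isT).
  rewrite !fctE /= linearZ /=.
  have -> : (s - t) *: (a - b) + p t = p s.
    by rewrite /p addrCA -scalerDl subrK.
  rewrite opprD addrA => /le_trans; apply.
  rewrite -ke mulrCA mulrA [leRHS]mulrAC.
  have : 0 <= k * `|s - t| by rewrite mulr_ge0 // ltW.
  by lra.
exact: dL (pM _ t01) _.
Qed.

Lemma heine_borel_rV (R : realType) (n : nat) : heine_borel 'rV[R]_n.
Proof.
move=> M; apply: bounded_closed_compact.
  by exists M; split; rewrite ?num_real // => N MN v /= /le_trans; apply; exact: ltW.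
apply: (closed_comp (f := fun v : 'rV[R]_n => `|v|) (D := [set r | r <= M])).
  by move=> v _; exact: norm_continuous.
exact: closed_le.
Qed.

Lemma heine_borel_real (R : realType) : heine_borel R.
Proof.
move=> M; rewrite (_ : [set _ | _] = `[- M, M]%classic); first exact: segment_compact.
by apply/seteqP; split=> v /=; rewrite in_itv /= ler_norml.
Qed.

Lemma heine_borel_prod (R : realType) (V W : normedModType R) :
  heine_borel V -> heine_borel W -> heine_borel (V * W)%type.
Proof.
move=> hV hW M.
rewrite (_ : [set _ | _] = [set v : V | `|v| <= M] `*` [set w : W | `|w| <= M]).
  by apply: compact_setX; [exact: hV | exact: hW].
apply/seteqP; split=> -[v w] /=; rewrite prod_normE /= ge_max.
  by move/andP.
by move=> [-> ->].
Qed.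

(** * Uniqueness and regularity of solutions *)

Lemma solution_deriv_at (R : realType) (V : normedModType R) (F : V -> V)
    (z : R -> V) : solution F z <->
  forall t, 0 <= t -> deriv_at [set s | 0 <= s] z t (F (z t)).
Proof.
have quot (s t : R) : s != t -> z s - z t - (s - t) *: F (z t) =
    (s - t) *: ((s - t)^-1 *: (z s - z t) - F (z t)).
  by move=> st; rewrite scalerBr scalerA divff ?scale1r // subr_eq0.
split=> hz t t0.
  move=> e e0; have /cvgrPdist_le/(_ _ e0) := hz t t0.
  case/nbhs_normP => d /= d0 H; exists d => // s s0 sd.
  have [->|st] := eqVneq s t; first by rewrite !subrr scale0r subr0 !normr0 mulr0.
  rewrite quot // normrZ mulrC ler_wpM2r // distrC.
  by apply: H => //; rewrite /ball_ /= distrC.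
apply/cvgrPdist_le => e e0; have [d d0 H] := hz t t0 e e0.
apply/nbhs_normP; exists d => // s /= sd st s0.
have sd' : `|s - t| < d by rewrite distrC.
have := H s s0 sd'; rewrite quot // normrZ mulrC.
by rewrite ler_pM2r ?normr_gt0 ?subr_eq0 // distrC.
Qed.

Lemma solution_shift (R : realType) (V : normedModType R) (F : V -> V)
    (z : R -> V) (c : R) :
  0 <= c -> solution F z -> solution F (fun s => z (s + c)).
Proof.
move=> c0 /solution_deriv_at hz; apply/solution_deriv_at => t t0 e e0.
have [|d d0 H] := hz (t + c) _ e e0; first exact: addr_ge0.
exists d => // s s0 sd; have := H (s + c).
have -> : s + c - (t + c) = s - t by lra.
by apply=> //; exact: addr_ge0.
Qed.

Lemma solution_deriv_on (R : realType) (V : normedModType R) (F : V -> V)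
    (z : R -> V) (a b : R) : solution F z -> 0 <= a ->
  forall t, a <= t <= b -> deriv_at `[a, b] z t (F (z t)).
Proof.
move=> /solution_deriv_at hz a0 t /andP[at_ _].
apply: deriv_at_sub (hz t (le_trans a0 at_)) => s /=.
by rewrite in_itv /= => /andP[/(le_trans a0)].
Qed.

Lemma solution_locally_bounded (R : realType) (V : normedModType R)
    (F : V -> V) (z : R -> V) (b : R) :
  solution F z -> exists M, forall t, 0 <= t <= b -> `|z t| <= M.
Proof.
move=> /solution_deriv_at hz.
have /compact_near_coveringP/(_ R +oo (fun i t => 0 <= t -> `|z t| <= i)) :=
  @segment_compact R 0 b.
case=> [t|M [_ HM]].
  rewrite /= in_itv /= => /andP[t0 _].
  have [d d0 H] := deriv_at_continuous (hz t t0) ltr01.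
  exists ([set s | `|s - t| < d], [set i | `|z t| + 1 <= i]).
    split; last by apply: nbhs_pinfty_ge; rewrite num_real.
    by apply/nbhs_normP; exists d => // s; rewrite /ball_ /= distrC.
  move=> [s i] /= [sd ti] s0; have := H s s0 sd.
  rewrite -[z s](subrK (z t)) addrK => ?; apply: (le_trans (ler_normD _ _)); lra.
exists (M + 1) => t t0b; have [t0 _] := andP t0b.
by apply: (HM (M + 1)); rewrite ?ltrDl ?ltr01 //= in_itv.
Qed.

(** Continuous dependence on the initial condition, locally uniform in time. *)
Lemma solution_dist (R : realType) (V : normedModType R) (F : V -> V)
    (z1 z2 : R -> V) (M L a b : R) : 0 <= L ->
    (forall v w, `|v| <= M -> `|w| <= M -> `|F v - F w| <= L * `|v - w|) ->
    solution F z1 -> solution F z2 -> 0 <= a <= b ->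
    (forall t, a <= t <= b -> `|z1 t| <= M /\ `|z2 t| <= M) ->
  `|z1 b - z2 b| <= `|z1 a - z2 a| * expR ((L + 1) * (b - a)).
Proof.
move=> L0 FL hz1 hz2 /andP[a0 ab] zM.
apply: (@gronwall _ _ a b L (fun t => z1 t - z2 t)
  (fun t => F (z1 t) - F (z2 t))) => // t atb.
  by apply: deriv_atB; exact: solution_deriv_on.
by have [] := zM t atb; exact: FL.
Qed.

(** F is Lipschitz only on balls, and nothing bounds the two solutions on the
    whole half-line; on the compact interval from a to t they are bounded. *)
Lemma solution_unique (R : realType) (V : normedModType R) (F : V -> V)
    (z1 z2 : R -> V) (a : R) : lipschitz_on_balls F ->
    solution F z1 -> solution F z2 -> 0 <= a -> z1 a = z2 a ->
  forall t, a <= t -> z1 t = z2 t.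
Proof.
move=> FL hz1 hz2 a0 z12 t at_.
have [M1 zM1] := solution_locally_bounded t hz1.
have [M2 zM2] := solution_locally_bounded t hz2.
have [L L0 HL] := FL (Num.max M1 M2).
have := @solution_dist _ _ F z1 z2 (Num.max M1 M2) L a t L0 HL hz1 hz2.
rewrite a0 at_ => /(_ isT); rewrite z12 subrr normr0 mul0r => H.
apply/eqP; rewrite -subr_eq0 -normr_le0; apply: H => s /andP[as_ st].
by rewrite !le_max zM1 ?zM2 ?orbT // st (le_trans a0).
Qed.

Lemma mean_value_dist (R : realType) (V : normedModType R) (M s t : R)
    (u v : R -> V) : 0 <= s -> 0 <= t ->
    (forall r, 0 <= r -> deriv_at [set r | 0 <= r] u r (v r)) ->
    (forall r, 0 <= r -> `|r - t| <= `|s - t| -> `|v r| <= M) ->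
  `|u s - u t| <= M * `|s - t|.
Proof.
move=> s0 t0 du vM.
have sub a b : 0 <= a -> forall r, a <= r <= b -> deriv_at `[a, b] u r (v r).
  move=> a0 r /andP[ar _]; apply: deriv_at_sub (du r (le_trans a0 ar)) => q /=.
  by rewrite in_itv /= => /andP[/(le_trans a0)].
have [st|ts] := leP s t.
  rewrite distrC [`|s - t|]distrC [`|t - s|]ger0_norm ?subr_ge0 //.
  apply: mean_value_ineq => //; first exact: sub.
  move=> r /andP[sr rt]; apply: vM; first lra.
  by rewrite distrC [leRHS]distrC !ger0_norm; lra.
rewrite [`|s - t|]gtr0_norm ?subr_gt0 //.
apply: mean_value_ineq; [exact: ltW | exact: sub |] => r /andP[tr rs].
apply: vM; first lra.
by rewrite !ger0_norm; lra.
Qed.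

(** The constants depend on z only through the ball that contains it, so that
    the bound survives a pointwise limit of solutions. *)
Lemma solution_taylor (R : realType) (V : normedModType R) (F : V -> V)
    (z : R -> V) (M L B : R) : 0 <= L ->
    (forall v w, `|v| <= M -> `|w| <= M -> `|F v - F w| <= L * `|v - w|) ->
    (forall v, `|v| <= M -> `|F v| <= B) ->
    solution F z -> (forall t, 0 <= t -> `|z t| <= M) ->
  forall s t, 0 <= s -> 0 <= t ->
    `|z s - z t - (s - t) *: F (z t)| <= L * B * `|s - t| * `|s - t|.
Proof.
move=> L0 FL FB /solution_deriv_at hz zM s t s0 t0.
have lip r : 0 <= r -> `|z r - z t| <= B * `|r - t|.
  move=> r0; apply: (@mean_value_dist _ _ B r t z (F \o z)) => // q q0 _.
  exact/FB/zM.
have -> : z s - z t - (s - t) *: F (z t) =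
    (z s - s *: F (z t)) - (z t - t *: F (z t)).
  by rewrite scalerBl !opprD !opprK [RHS]addrACA.
apply: (@mean_value_dist _ _ (L * B * `|s - t|) s t
  (fun r => z r - r *: F (z t)) (fun r => F (z r) - F (z t))) => // r r0 rs.
  by apply: deriv_atB; [exact: hz | exact: deriv_at_scale].
have B0 : 0 <= B by exact: le_trans (FB _ (zM t t0)).
apply: (le_trans (FL _ _ (zM r r0) (zM t t0))); rewrite -mulrA ler_wpM2l //.
by apply: (le_trans (lip r r0)); rewrite ler_wpM2l.
Qed.

(** * Limit points of a trajectory *)

(** The limit points of one given trajectory.  By uniqueness these are the
    elements of [omega], but this form involves neither a choice of sequence nor
    a quantifier over solutions. *)
Definition traj_limit {R : realType} {V : normedModType R}
    (z : R -> V) (p : V) : Prop :=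
  forall e A : R, 0 < e -> exists2 t, A <= t & `|z t - p| < e.

Lemma traj_limit_seq (R : realType) (V : normedModType R) (z : R -> V) (p : V) :
  traj_limit z p -> exists t : R^nat, [/\ forall k, 0 <= t k,
    t k @[k --> \oo] --> +oo & z (t k) @[k --> \oo] --> p].
Proof.
move=> zp.
have /choice[t ht] : forall k : nat, exists t,
    k%:R <= t /\ `|z t - p| < k.+1%:R^-1.
  by move=> k; have [|t kt tp] := zp k.+1%:R^-1 k%:R; [|exists t].
exists t; split.
- by move=> k; apply: (le_trans (ler0n _ k)); case: (ht k).
- apply/cvgryPge => A; near=> k.
  have [kt _] := ht k; apply: le_trans kt.
  near: k; exact: nbhs_infty_ger.
- apply/cvgrPdist_lt => e e0; near=> k; rewrite distrC.
  have [_ /lt_trans] := ht k; apply.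
  near: k; exact: (near_infty_natSinv_lt (PosNum e0)).
Unshelve. all: by end_near. Qed.

Lemma seq_traj_limit (R : realType) (V : normedModType R) (z : R -> V) (p : V)
    (t : R^nat) :
  t k @[k --> \oo] --> +oo -> z (t k) @[k --> \oo] --> p -> traj_limit z p.
Proof.
move=> /cvgryPge too /cvgrPdist_lt tp e A e0.
have [k [Ak kp]] : exists k, A <= t k /\ `|p - z (t k)| < e.
  by apply: (@filter_ex _ \oo); apply: filterI; [exact: too | exact: tp].
by exists (t k) => //; rewrite distrC.
Qed.

(** Along times at which x tends to p, the bounded y has a cluster point. *)
Lemma traj_limit_lift (R : realType) (V W : normedModType R) (x : R -> V)
    (y : R -> W) (p : V) (M : R) : heine_borel W ->
    (forall t, 0 <= t -> `|y t| <= M) -> traj_limit x p ->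
  exists q, traj_limit (fun t => (x t, y t)) (p, q).
Proof.
move=> hW yM /traj_limit_seq[t [t0 /cvgryPge too /cvgrPdist_lt tp]].
have [|q [_ qc]] := hW M ((y \o t) @ \oo) _.
  by exists 0%N => // k _ /=; exact: yM.
exists q => e A e0.
have [|_ [[k /= [Ak kp] <-] kq]] := qc ((y \o t) @`
    [set k | A <= t k /\ `|p - x (t k)| < e]) (ball q e) _ (nbhsx_ballx _ _ e0).
  apply: (@filterS _ \oo _ [set k | A <= t k /\ `|p - x (t k)| < e]).
    by move=> k Hk; exists k.
  by apply: filterI; [exact: too | exact: tp].
exists (t k) => //; rewrite prod_normE /= gt_max distrC kp /= distrC.
by move: kq; rewrite -ball_normE.
Qed.

Lemma traj_limit_closed (R : realType) (V : normedModType R) (z : R -> V) :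
  closed [set p | traj_limit z p].
Proof.
move=> p pc e A e0.
have e20 : 0 < e / 2 by lra.
have [q [/= zq]] := pc (ball p (e / 2)) (nbhsx_ballx _ _ e20).
rewrite -ball_normE /= => pq; have [t At tq] := zq _ A e20.
exists t => //; apply: (le_lt_trans (ler_distD q _ _)).
by rewrite [`|q - p|]distrC; lra.
Qed.

Lemma traj_limit_bounded (R : realType) (V : normedModType R) (z : R -> V) p M :
  (forall t, 0 <= t -> `|z t| <= M) -> traj_limit z p -> `|p| <= M.
Proof.
move=> zM zp; apply/ler_addgt0Pr => e e0.
have [t t0 tp] := zp e 0 e0.
rewrite -[p](subrK (z t)) addrC; apply: (le_trans (ler_normD _ _)).
by rewrite distrC; have := zM t t0; lra.
Qed.

Lemma traj_limit_omega (R : realType) (V : normedModType R) (F : V -> V)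
    (z : R -> V) (p : V) : solution F z -> traj_limit z p -> omega F (z 0) p.
Proof. by move=> hz /traj_limit_seq; exists z. Qed.

Lemma omega_traj_limit (R : realType) (V : normedModType R) (F : V -> V)
    (z : R -> V) (p : V) : lipschitz_on_balls F ->
  solution F z -> omega F (z 0) p -> traj_limit z p.
Proof.
move=> hF hz [z' [hz' zz']] [t [t0 too tp]].
apply: (seq_traj_limit too).
have -> : (fun k => z (t k)) = (fun k => z' (t k)); last by [].
by apply/funext => k; apply: (solution_unique hF hz hz' (lexx 0)).
Qed.

(** * Invariance of the limit set *)

Lemma cluster_cauchy_cvg (R : realType) (V : normedModType R) (u : nat -> V)
    (c : V) : cluster (u @ \oo) c ->
    (forall e, 0 < e -> exists N : nat, forall k l, (N <= k)%N -> (N <= l)%N ->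
      `|u k - u l| <= e) ->
  u @ \oo --> c.
Proof.
move=> uc hu; apply/cvgrPdist_le => e e0.
have e20 : 0 < e / 2 by lra.
have [N HN] := hu _ e20.
have [|_ [[l /= Nl <-] lc]] := uc (u @` [set l | (N <= l)%N]) (ball c (e / 2)) _
  (nbhsx_ballx _ _ e20).
  by exists N => // l Nl; exists l.
move: lc; rewrite -ball_normE /= => lc.
exists N => // k Nk.
apply: (le_trans (ler_distD (u l) _ _)); have := HN l k Nl Nk; lra.
Qed.

(** The solution through w0 is the pointwise limit of the translates
    z(t_k + s), where z(t_k) tends to w0. *)
Lemma limit_set_invariant (R : realType) (V : normedModType R) (F : V -> V)
    (z : R -> V) (M : R) (w0 : V) : heine_borel V -> lipschitz_on_balls F ->
    solution F z -> (forall t, 0 <= t -> `|z t| <= M) -> traj_limit z w0 ->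
  exists w, [/\ solution F w, w 0 = w0 &
    forall s, 0 <= s -> traj_limit z (w s)].
Proof.
move=> hV hF hz zM /traj_limit_seq[t [t0 too tw0]].
have [L L0 HL] := hF M.
have /choice[w hw] : forall s : R, exists c : V, 0 <= s -> z (t k + s) @[k --> \oo] --> c.
  move=> s; have [s0|s0] := leP 0 s; last by exists 0.
  have [|c [_ cc]] := hV M ((fun k => z (t k + s)) @ \oo) _.
    by exists 0%N => // k _ /=; apply: zM; exact: addr_ge0.
  exists c => _; apply: cluster_cauchy_cvg => // e e0.
  (* a time s multiplies the distance between two translates by at most K *)
  set K := expR ((L + 1) * s); have K0 : 0 < K by exact: expR_gt0.
  have e20 : 0 < e / K / 2 by rewrite !divr_gt0.
  move/cvgrPdist_le: tw0 => /(_ _ e20) [N _ HN]; exists N => k l Nk Nl.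
  have := @solution_dist _ _ F (fun r => z (r + t k)) (fun r => z (r + t l))
    M L 0 s L0 HL (solution_shift (t0 k) hz) (solution_shift (t0 l) hz).
  rewrite lexx s0 /= !add0r subr0 ![s + _]addrC -/K => H.
  apply: (le_trans (H _ _)) => //.
    by move=> r /andP[r0 _]; split; apply: zM; exact: addr_ge0.
  rewrite -ler_pdivlMr //; apply: (le_trans (ler_distD w0 _ _)).
  by have := HN k Nk; have := HN l Nl; rewrite /= [`|w0 - z (t k)|]distrC; lra.
have wM s : 0 <= s -> `|w s| <= M.
  move=> s0; have /cvg_norm := hw s s0.
  apply: (@closed_cvg _ _ _ _ _ (fun x : R => x <= M)); first exact: closed_le.
  by exists 0%N => // k _ /=; apply: zM; exact: addr_ge0.
exists w; split.
- pose B := L * M + `|F 0|.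
  have FB v : `|v| <= M -> `|F v| <= B.
    move=> vM; have M0 : `|0 : V| <= M by rewrite normr0 (le_trans _ vM).
    rewrite -[F v](subrK (F 0)); apply: (le_trans (ler_normD _ _)).
    rewrite lerD2r; apply: (le_trans (HL _ _ vM M0)); rewrite subr0.
    by rewrite ler_wpM2l.
  have Q s r : 0 <= s -> 0 <= r ->
      `|w s - w r - (s - r) *: F (w r)| <= L * B * `|s - r| * `|s - r|.
    move=> s0 r0.
    have cF : F (z (t k + r)) @[k --> \oo] --> F (w r).
      apply/cvgrPdist_le => e e0.
      have L10 : 0 < L + 1 by lra.
      have e'0 : 0 < e / (L + 1) by rewrite divr_gt0.
      have /cvgrPdist_le/(_ _ e'0) := hw r r0.
      apply: filterS => k; rewrite ler_pdivlMr // => H.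
      apply: (le_trans (HL _ _ (wM r r0) (zM _ (addr_ge0 (t0 k) r0)))).
      by have := normr_ge0 (w r - z (t k + r)); lra.
    have wsr : `|z (t k + s) - z (t k + r) - (s - r) *: F (z (t k + r))|
        @[k --> \oo] --> `|w s - w r - (s - r) *: F (w r)|.
      apply: cvg_norm; apply: cvgB; first by apply: cvgB; exact: hw.
      by apply: cvgZ => //; exact: cvg_cst.
    apply: (closed_cvg (fun x : R => x <= L * B * `|s - r| * `|s - r|) _ _ _ wsr).
      exact: closed_le.
    exists 0%N => // k _ /=.
    have := @solution_taylor _ _ F z M L B L0 HL FB hz zM (t k + s) (t k + r).
    have -> : t k + s - (t k + r) = s - r by lra.
    by apply; exact: addr_ge0.
  (* a quadratic remainder is a little-o of |s - r| *)
  apply/solution_deriv_at => r r0 e e0.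
  have B0 : 0 <= L * B.
    by rewrite mulr_ge0 // (le_trans _ (FB _ (wM r r0))).
  exists (e / (L * B + 1)); first by rewrite divr_gt0 // ltr_wpDl.
  move=> s s0; rewrite ltr_pdivlMr ?ltr_wpDl // => sr.
  apply: (le_trans (Q s r s0 r0)); rewrite ler_wpM2r //.
  by have := normr_ge0 (s - r); lra.
- have := hw 0 (lexx 0); under eq_fun do rewrite addr0.
  by move=> /norm_cvg_unique; apply.
- move=> s s0; apply: (@seq_traj_limit _ _ _ _ (fun k => t k + s)) (hw s s0).
  apply/cvgryPge => A; move/cvgryPge: too => /(_ A).
  by apply: filterS => k /le_trans; apply; rewrite lerDl.
Qed.

(** * Cascades *)

Lemma norm_fst (R : realType) (V W : normedModType R) (p : V * W) : `|p.1| <= `|p|.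
Proof. by rewrite prod_normE le_max lexx. Qed.

Lemma norm_snd (R : realType) (V W : normedModType R) (p : V * W) : `|p.2| <= `|p|.
Proof. by rewrite prod_normE le_max lexx orbT. Qed.

Lemma deriv_at_fst (R : realType) (V W : normedModType R) (A : set R)
    (u : R -> V * W) (t : R) (v : V * W) :
  deriv_at A u t v -> deriv_at A (fun s => (u s).1) t v.1.
Proof.
move=> du e /du[d d0 H]; exists d => // s As sd.
exact: le_trans (norm_fst _) (H s As sd).
Qed.

Lemma deriv_at_snd (R : realType) (V W : normedModType R) (A : set R)
    (u : R -> V * W) (t : R) (v : V * W) :
  deriv_at A u t v -> deriv_at A (fun s => (u s).2) t v.2.
Proof.
move=> du e /du[d d0 H]; exists d => // s As sd.
exact: le_trans (norm_snd _) (H s As sd).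
Qed.

Lemma cascade_lipschitz (R : realType) (n : nat) (f : 'rV[R]_n -> 'rV[R]_n)
    (g : 'rV[R]_n * R -> R) :
  lipschitz_on_balls f -> lipschitz_on_balls g -> lipschitz_on_balls (cascade f g).
Proof.
move=> hf hg M; have [Lf Lf0 Hf] := hf M; have [Lg Lg0 Hg] := hg M.
exists (Num.max Lf Lg); first by rewrite le_max Lf0.
move=> a b aM bM; rewrite prod_normE /= ge_max; apply/andP; split.
  apply: (le_trans (Hf _ _ (le_trans (norm_fst _) aM) (le_trans (norm_fst _) bM))).
  by apply: ler_pM; rewrite ?le_max ?lexx // (norm_fst (a - b)).
apply: (le_trans (Hg _ _ aM bM)).
by rewrite ler_wpM2r // le_max lexx orbT.
Qed.

Lemma cascade_solution_fst (R : realType) (n : nat) (f : 'rV[R]_n -> 'rV[R]_n)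
    (g : 'rV[R]_n * R -> R) (w : R -> 'rV[R]_n * R) :
  solution (cascade f g) w -> solution f (fun t => (w t).1).
Proof.
move=> /solution_deriv_at hw; apply/solution_deriv_at => t t0.
exact: deriv_at_fst (hw t t0).
Qed.

(** Solutions over a common base solution keep their vertical order: to
    exchange it they would have to meet, and would then coincide. *)
Lemma cascade_monotone (R : realType) (n : nat) (f : 'rV[R]_n -> 'rV[R]_n)
    (g : 'rV[R]_n * R -> R) (w1 w2 : R -> 'rV[R]_n * R) :
    lipschitz_on_balls (cascade f g) ->
    solution (cascade f g) w1 -> solution (cascade f g) w2 ->
    (forall t, 0 <= t -> (w1 t).1 = (w2 t).1) -> (w1 0).2 <= (w2 0).2 ->
  forall t, 0 <= t -> (w1 t).2 <= (w2 t).2.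
Proof.
move=> hlip hw1 hw2 w12 w120 t t0; rewrite leNgt; apply/negP => w21.
pose h s := (w1 s).2 - (w2 s).2.
have hc : {within `[0, t], continuous h}.
  apply/subspace_continuousP => s /=; rewrite in_itv /= => st.
  apply/cvgrPdist_le => e e0.
  have dh := deriv_atB (deriv_at_snd (solution_deriv_on hw1 (lexx 0) st))
    (deriv_at_snd (solution_deriv_on hw2 (lexx 0) st)).
  have [d d0 H] := deriv_at_continuous dh e0.
  apply/nbhs_normP; exists d => // r /= rd r0t.
  by rewrite distrC; apply: H; rewrite //= distrC.
(* the y-components agree at some c <= t *)
have [|c /=] := IVT (v := 0) t0 hc.
  by rewrite ge_min le_max /h subr_le0 !subr_ge0 w120 (ltW w21) orbT.
rewrite in_itv /= => /andP[c0 ct] hc0.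
have w12c : w1 c = w2 c.
  rewrite [w1 c]surjective_pairing [w2 c]surjective_pairing w12 //.
  by congr (_, _); apply/eqP; rewrite -subr_eq0; apply/eqP.
by move: w21; rewrite (solution_unique hlip hw1 hw2 c0 w12c ct) ltxx.
Qed.

(** * Monotone maps on compact sets of reals *)

Lemma closed_inf (R : realType) (K : set R) :
  K !=set0 -> has_lbound K -> closed K -> K (inf K).
Proof.
move=> K0 Klb Kc; apply: Kc => B /nbhs_ballP[e /= e0 KB].
have [q Kq qe] := inf_adherent e0 (conj K0 Klb).
exists q; split=> //; apply: KB; rewrite -ball_normE /= distrC ger0_norm.
  by rewrite ltrBlDl.
by rewrite subr_ge0; exact: ge_inf.
Qed.

(** Tarski's argument: the supremum of the q with q <= P q is a fixed point.
    Since K is closed, that supremum lies in K, where the monotonicity of P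
    can be applied to it; the same holds for inf K, which shows that such q
    exist. *)
Lemma monotone_fixpoint (R : realType) (K : set R) (M : R) (P : R -> R) :
    K !=set0 -> closed K -> (forall q, K q -> `|q| <= M) ->
    (forall q, K q -> K (P q)) ->
    (forall q r, K q -> K r -> q <= r -> P q <= P r) ->
  exists2 q, K q & P q = q.
Proof.
move=> K0 Kc KM KP Pmono.
have Klb : has_lbound K.
  by exists (- M) => q /KM; rewrite ler_norml => /andP[].
pose S := [set q | K q /\ q <= P q].
have S0 : S !=set0.
  exists (inf K); have Ki := closed_inf K0 Klb Kc.
  by split=> //; apply: ge_inf => //; exact: KP.
have Sub : has_ubound S.
  by exists M => q [/KM]; rewrite ler_norml => /andP[].
have Ks : K (sup S).
  by apply: Kc; apply: (closure_subset (A := S)); [move=> q [] | exact: closure_sup].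
have sP : sup S <= P (sup S).
  apply: ge_sup => // q [Kq qP]; apply: (le_trans qP); apply: Pmono => //.
  exact: ub_le_sup.
exists (sup S) => //; apply/eqP; rewrite eq_le sP andbT.
by apply: ub_le_sup => //; split; [exact: KP | apply: Pmono => //; exact: KP].
Qed.

(** * Periodic orbits in the limit set *)

Theorem theorem3 (R : realType) (n : nat)
    (f : 'rV[R]_n -> 'rV[R]_n) (g : 'rV[R]_n * R -> R)
    (hf : classC1 f) (hg : classC1 g)
    (x0 : 'rV[R]_n) (y0 : R) (x : R -> 'rV[R]_n) (y : R -> R)
    (hsol : solution (cascade f g) (fun t => (x t, y t)))
    (hx0 : x 0 = x0) (hy0 : y 0 = y0)
    (hbnd : [bounded (x t, y t) | t in `[0, +oo[])
    (T : R) (hT : 0 < T)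
    (hper : exists2 O : set 'rV[R]_n,
        periodic_orbit f T O & O `<=` omega f x0) :
  exists2 O : set ('rV[R]_n * R),
    periodic_orbit (cascade f g) T O & O `<=` omega (cascade f g) (x0, y0).
Proof.
have hbV := @heine_borel_rV R n.
have hbR := @heine_borel_real R.
have hbP := heine_borel_prod hbV hbR.
have lf := classC1_lipschitz hbV hf.
have lF := cascade_lipschitz lf (classC1_lipschitz hbP hg).
set z := (fun t => (x t, y t)) in hsol *.
have [M zM] : exists M, forall t, 0 <= t -> `|z t| <= M.
  case: hbnd => M0 [_ /(_ (M0 + 1))]; rewrite ltrDl ltr01 => /(_ isT) H.
  by exists (M0 + 1) => t t0; apply: H; rewrite /= in_itv /= t0.
have [_ [xs [hxs xsT ->]] Oom] := hper.
have xp : traj_limit x (xs 0).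
  apply: (omega_traj_limit lf (cascade_solution_fst hsol)).
  by rewrite /= hx0; apply: Oom; exists 0; rewrite //= in_itv /= lexx ltW.
(* the fibre over xs 0 of the limit set, on which q |-> (w q T).2 acts *)
pose K := [set q | traj_limit z (xs 0, q)].
have flow q : exists w, K q -> [/\ solution (cascade f g) w, w 0 = (xs 0, q) &
    forall s, 0 <= s -> traj_limit z (w s)].
  have [Kq|nKq] := pselect (K q); last by exists (fun=> 0).
  by have [w hw] := limit_set_invariant hbP lF hsol zM Kq; exists w.
case/choice: flow => w hw.
have w1 q t : K q -> 0 <= t -> (w q t).1 = xs t.
  move=> /hw[sw w0 _] t0.
  apply: (solution_unique lf (cascade_solution_fst sw) hxs (lexx 0)) => //.
  by rewrite w0.
have wT q : K q -> w q T = (xs 0, (w q T).2).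
  move=> Kq; rewrite [LHS]surjective_pairing w1 ?(ltW hT) //.
  by rewrite -[T in xs T]add0r xsT.
have [|||||q Kq wq] := @monotone_fixpoint R K M (fun q => (w q T).2).
- apply: traj_limit_lift hbR _ xp => t t0.
  exact: le_trans (norm_snd _) (zM t t0).
- exact: (continuous_closedP _).1 (fun _ => cvg_pair (cvg_cst _) cvg_id) _
    (@traj_limit_closed _ _ z).
- move=> q /(traj_limit_bounded zM); exact: le_trans (norm_snd _).
- move=> q Kq; rewrite /K /= -wT //.
  by have [_ _] := hw q Kq; apply; exact: ltW.
- move=> q r Kq Kr qr; have [sq q0 _] := hw q Kq; have [sr r0 _] := hw r Kr.
  apply: (cascade_monotone lF sq sr) (ltW hT); last by rewrite q0 r0.
  by move=> t t0; rewrite !w1.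
have [sw w0 wz] := hw q Kq.
exists (w q @` `[0, T]); last first.
  move=> _ [t + <-]; rewrite /= in_itv /= => /andP[t0 _].
  by rewrite -hx0 -hy0; exact: (traj_limit_omega hsol (wz t t0)).
exists (w q); split=> //.
apply: (solution_unique lF (solution_shift (ltW hT) sw) sw (lexx 0)).
by rewrite add0r wT // wq w0.
Qed.
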